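(* There is a function $g(x,y,z):\mathbb{R}^{3}\rightarrow\mathbb{R}^{+}$ with the following property. Let $n$ be a positive integer, let $(f_{i},f_{i}^{*})_{i=1}^{n}$ be any biorthogonal system with constant $d$, $0<d\le 1$, and Hilbertian constant $L$ in an $n$-dimensional Hilbert space $H_{n}$, and let $0<\epsilon<1$. Then there is a subset $\sigma\subset\{1,2,\ldots,n\}$ with $|\sigma|\ge(1-\epsilon)n$ such that $(f_{i})_{i\in\sigma}$ is a Riesz basis for its span with Riesz basis constant $g(\epsilon,d,L)$. (In particular, $g$ does not depend on $n$, $H_n$ or the system.)
   Context: A family $(f_{i},f_{i}^{*})_{i\in I}$ in a Hilbert space $H$ is a biorthogonal system with constant $d$ if $\|f_{i}\|=1$ and $\|f_{i}^{*}\|\le d^{-1}$ for all $i\in I$, and $\langle f_{i}^{*},f_{j}\rangle=\delta_{ij}$ for all $i,j\in I$. It has Hilbertian constant $L$ if $\left\|\sum_{i\in I}a_{i}f_{i}\right\|\le L\left(\sum_{i\in I}|a_{i}|^{2}\right)^{1/2}$ for all scalars $(a_{i})_{i\in I}$. A family $(f_{i})_{i\in I}$ is a Riesz basis for its span with Riesz basis constant $M$ if $\frac{1}{M}\left(\sum_{i\in I}|a_{i}|^{2}\right)^{1/2}\le \left\|\sum_{i\in I}a_{i}f_{i}\right\|\le M\left(\sum_{i\in I}|a_{i}|^{2}\right)^{1/2}$ for every choice of scalars $(a_{i})_{i\in I}$. *)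

(* Defs.v *)
From HB Require Import structures.
From mathcomp Require Import all_boot all_order all_algebra.
From mathcomp Require Import reals complex.

Set Implicit Arguments.
Unset Strict Implicit.
Unset Printing Implicit Defensive.

Import Order.TTheory GRing.Theory Num.Theory Num.Def.

Local Open Scope ring_scope.

(* Real and complex Hilbert spaces are treated uniformly: an inner product space
   over K is an lmodType K with a form {dot V for theta}, where
   - K = R,    theta = idfun, re = idfun  in the real case,
   - K = R[i], theta = conjC, re = Re     in the complex case.
   The map re : K -> R only serves to read the values <v, v> and `|a|, which are
   real but have type K, as elements of R. *)
Section Systems.
Variables (R : rcfType) (K : numFieldType) (theta : K -> K) (re : K -> R).

Definition l2norm (I : finType) (s : {set I}) (a : I -> K) : R :=
  Num.sqrt (\sum_(i in s) re `|a i| ^+ 2).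

Variables (V : lmodType K) (dp : {dot V for theta}).

Definition dotnorm (v : V) : R := Num.sqrt (re (dp v v)).

Variable I : finType.

Definition biorthogonal_system (f fs : I -> V) (d : R) : Prop :=
  [/\ forall i, dotnorm (f i) = 1,
      forall i, dotnorm (fs i) <= d^-1
    & forall i j, dp (fs i) (f j) = (i == j)%:R].

Definition hilbertian_constant (f : I -> V) (L : R) : Prop :=
  forall a : I -> K, dotnorm (\sum_i a i *: f i) <= L * l2norm [set: I] a.

(* The subfamily (f i), i in s; coefficients a i with i outside s are ignored. *)
Definition riesz_basis_constant (s : {set I}) (f : I -> V) (M : R) : Prop :=
  forall a : I -> K,
    M^-1 * l2norm s a <= dotnorm (\sum_(i in s) a i *: f i) <= M * l2norm s a.

End Systems.

Arguments l2norm {R K} re {I} s a.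
Arguments dotnorm {R K theta} re {V} dp v.
Arguments biorthogonal_system {R K theta} re {V} dp {I} f fs d.
Arguments hilbertian_constant {R K theta} re {V} dp {I} f L.
Arguments riesz_basis_constant {R K theta} re {V} dp {I} s f M.

(* Main.v *)
Require Import Defs.
From HB Require Import structures.
From mathcomp Require Import all_boot all_order all_algebra.
From mathcomp Require Import reals complex.
From mathcomp Require Import ring lra.

Set Implicit Arguments.
Unset Strict Implicit.
Unset Printing Implicit Defensive.

Import Order.TTheory GRing.Theory Num.Theory Num.Def.

(** Let A be the Gram matrix of the f_i.  It is positive definite, and the
    diagonal entries of A^-1 are at most |f_i^*|^2 <= d^-2, because they are the
    squared norms of the projections of the f_i^* on the span of the f_i.  Hence
    the trace of A^-1 is at most phi := n / d^2.  A lower Riesz bound for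
    (f_i), i in sigma, is a lower bound for the principal submatrix of A on
    sigma, so it suffices to delete at most eps * n indices of A and be left
    with a matrix that is bounded below by a multiple of eps * d^2.

    The indices are deleted one at a time under a barrier.  Let M be positive
    definite with tr M^-1 <= phi, and delta := 1 / (2 phi).  Then M >= 1 / phi,
    so N := M - delta is at least M / 2: it is still positive definite, and
    N^-1 <= 2 M^-1 gives tr N^-1 <= 2 phi = 1 / delta.  Subtracting delta raises
    the trace of the inverse by at most delta * tr N^-2.
    Deleting the index j lowers tr N^-1 by (N^-2)_jj / (N^-1)_jj, and an
    average over j weighted by (N^-1)_jj shows that for some j this is at least
    tr N^-2 / tr N^-1 >= delta * tr N^-2.  So some deletion pays for the
    subtraction, and the trace of the inverse is again at most phi
    ([barrier_step]).

    After k deletions the remaining principal submatrix exceeds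
    k / (2 phi) by a matrix that is itself at least 1 / phi
    ([barrier_selection], [sqnorm_le_form]).  With k the integer part of
    eps * n this gives the bound (k + 1) / (2 phi) >= eps * d^2 / 2, and at
    least (1 - eps) * n indices are left.  The upper Riesz bound is the
    Hilbertian constant L ([biorthogonal_riesz]).

    Real and complex scalars are covered by the same argument, over a field K
    with an involution theta such that x * theta x = |x|^2. *)

Local Open Scope ring_scope.

(** * Positive definite Hermitian matrices *)

Section PositiveDefinite.
Local Open Scope sesquilinear_scope.
Variables (K : numFieldType) (theta : involutive_rmorphism K).
Hypothesis normKE : forall x : K, x * theta x = `|x| ^+ 2.

Lemma theta_ge0 (x : K) : 0 <= x -> theta x = x.
Proof.
move=> x_ge0; have [->|x_neq0] := eqVneq x 0; first by rewrite rmorph0.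
by apply: (mulfI x_neq0); rewrite normKE ger0_norm // expr2.
Qed.

Definition posdefmx m (M : 'M[K]_m) :=
  M \is (false, theta : {rmorphism K -> K}).-sesqui
  /\ forall u, u != 0 -> 0 < form theta M u u.

Definition sqnorm m (u : 'rV[K]_m) := \sum_j `|u 0 j| ^+ 2.

Lemma sqnorm_ge0 m (u : 'rV[K]_m) : 0 <= sqnorm u.
Proof. by apply: sumr_ge0 => j _; rewrite exprn_ge0. Qed.

Lemma form1E m (u : 'rV[K]_m) : form theta 1%:M u u = sqnorm u.
Proof.
by rewrite /form mulmx1 mxE; apply: eq_bigr => j _; rewrite !mxE normKE.
Qed.

Lemma form_shift m (M : 'M[K]_m) a u :
  form theta (M - a%:M) u u = form theta M u u - a * sqnorm u.
Proof.
rewrite -form1E /form mulmxBr mulmxBl mul_mx_scalar mulmx1 -scalemxAl.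
by rewrite mxE; congr (_ + _); rewrite !mxE.
Qed.

Section Fixed.
Variables (m : nat) (M : 'M[K]_m).
Hypothesis M_pd : posdefmx M.

Lemma posdefmx_entryC i j : M i j = theta (M j i).
Proof.
by have /sesquiP/matrixP/(_ i j) := proj1 M_pd; rewrite /= expr0 scale1r !mxE.
Qed.

Lemma posdefmx_formC u v : form theta M u v = theta (form theta M v u).
Proof.
by case: M_pd => Ms _; rewrite (formC (@rmorphK _ theta) Ms) expr0 mul1r.
Qed.

Lemma posdefmx_form_ge0 u : 0 <= form theta M u u.
Proof.
have [->|/(proj2 M_pd)/ltW //] := eqVneq u 0.
by rewrite form0l.
Qed.

Lemma posdefmx_unit : M \in unitmx.
Proof.
rewrite -row_free_unit; apply: inj_row_free => v vM0.
apply/eqP/negPn/negP => /(proj2 M_pd).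
by rewrite /form vM0 mul0mx mxE ltxx.
Qed.

Let B := invmx M.

(** The rows of M^-1 are the family dual to the standard basis for the inner
    product given by M; all later inequalities between M and M^-1 come from
    this. *)
Lemma form_row_inv j v : form theta M (row j B) v = theta (v 0 j).
Proof.
by rewrite /form -row_mul mulVmx ?posdefmx_unit // -row_mul mul1mx !mxE.
Qed.

Lemma invmx_entryC i j : B i j = theta (B j i).
Proof.
have := posdefmx_formC (row i B) (row j B).
by rewrite !form_row_inv ![row _ _ _ _]mxE rmorphK.
Qed.

Lemma form_row_inv_diag j : form theta M (row j B) (row j B) = B j j.
Proof. by rewrite form_row_inv mxE -invmx_entryC. Qed.

Lemma invmx_diag_gt0 j : 0 < B j j.
Proof.
rewrite -form_row_inv_diag; apply: (proj2 M_pd); apply/negP => /eqP b0.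
have := form_row_inv j 'e_j; rewrite b0 form0l !mxE !eqxx rmorph1.
by move/eqP; rewrite eq_sym oner_eq0.
Qed.

(** Expanding the square of [row j B - v] for the inner product M: the quantity
    2 Re v_j - M(v, v) is maximal at v = [row j B], with value B_jj.  This
    variational formula is used with test vectors taken from other matrices. *)
Lemma invmx_diag_ge j (v : 'rV_m) :
  v 0 j + theta (v 0 j) - form theta M v v <= B j j.
Proof.
rewrite -subr_ge0; have := posdefmx_form_ge0 (row j B - v).
rewrite formDl !formDr !formNl !formNr opprK form_row_inv_diag.
rewrite (posdefmx_formC v) !form_row_inv rmorphK.
by congr (_ <= _); ring.
Qed.

Lemma coord_le_form j (v : 'rV_m) : `|v 0 j| ^+ 2 <= B j j * form theta M v v.
Proof.
have [->|v_neq0] := eqVneq v 0; first by rewrite mxE form0l normr0 expr0n mulr0.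
have F_gt0 := proj2 M_pd v v_neq0; set F := form _ _ _ _ in F_gt0 *.
have F_real : theta F^-1 = F^-1 by apply: theta_ge0; rewrite invr_ge0 ltW.
(* This multiple of v maximizes the left-hand side of the variational formula
   on the line through v. *)
have := invmx_diag_ge j ((theta (v 0 j) / F) *: v).
rewrite mxE formZl formZr -/F !rmorphM /= rmorphK F_real.
have -> : theta (v 0 j) / F * v 0 j = `|v 0 j| ^+ 2 / F.
  by rewrite -normKE mulrAC [theta _ * _]mulrC.
have -> : v 0 j / F * theta (v 0 j) = `|v 0 j| ^+ 2 / F.
  by rewrite -normKE mulrAC.
have -> : theta (v 0 j) / F * (v 0 j / F * F) = `|v 0 j| ^+ 2 / F.
  by rewrite divfK ?gt_eqF // -normKE mulrAC [theta _ * _]mulrC.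
by rewrite addrK ler_pdivrMr.
Qed.

(** In operator terms, M >= 1 / tr M^-1. *)
Lemma sqnorm_le_form v : sqnorm v <= \tr B * form theta M v v.
Proof. by rewrite mulr_suml; apply: ler_sum => j _; apply: coord_le_form. Qed.

End Fixed.

Lemma posdefmx_mxsub m p (h : 'I_p -> 'I_m) (M : 'M[K]_m) :
  injective h -> posdefmx M -> posdefmx (mxsub h h M).
Proof.
move=> h_inj M_pd; split.
  by apply/sesquiP/matrixP => i j; rewrite expr0 scale1r !mxE (posdefmx_entryC M_pd).
move=> u u_neq0; pose P : 'M[K]_(p, m) := rowsub h 1%:M.
have -> : form theta (mxsub h h M) u u = form theta M (u *m P) (u *m P).
  rewrite /form trmx_mul map_mxM !mulmxA.
  rewrite (_ : mxsub h h M = P *m M *m (P ^t theta)) ?mulmxA //.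
  rewrite /P mul_rowsub_mx mul1mx.
  rewrite -[M in LHS]mulmx1 mxsub_mul; congr (_ *m _).
  by apply/matrixP => i j; rewrite !mxE eq_sym; case: eqP; rewrite ?rmorph1 ?rmorph0.
apply: (proj2 M_pd); apply: contra_neq u_neq0 => uP0.
have : u *m P *m colsub h 1%:M = 0 by rewrite uP0 mul0mx.
rewrite -mulmxA -mxsub_mul mulmx1 => <-.
rewrite (_ : mxsub _ _ _ = 1%:M) ?mulmx1 //.
by apply/matrixP => i j; rewrite !mxE (inj_eq h_inj).
Qed.

(** * Deleting an index *)

(** The Schur complement formula, read on the inverse: a row and a column are
    cleared from M^-1 by the pivot (M^-1)_jj. *)
Lemma invmx_delete m (M : 'M[K]_m.+1) j :
  M \in unitmx -> invmx M j j != 0 ->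
  invmx (mxsub (lift j) (lift j) M) =
    \matrix_(i, k) (invmx M (lift j i) (lift j k)
                    - invmx M (lift j i) j * invmx M j (lift j k) / invmx M j j).
Proof.
move=> M_unit; set C := invmx M => Cjj; set N := mxsub _ _ M; set C' := \matrix_(i, k) _.
suff C'N : C' *m N = 1%:M.
  have [_ N_unit] := mulmx1_unit C'N.
  by rewrite -[LHS]mul1mx -C'N -mulmxA mulmxV // mulmx1.
have CM i k : \sum_(l < m) C i (lift j l) * M (lift j l) k = (i == k)%:R - C i j * M j k.
  have /matrixP/(_ i k) := mulVmx M_unit; rewrite !mxE (bigD1_ord j) //= => <-.
  by rewrite addrC addrK.
apply/matrixP => i k; rewrite !mxE.
under eq_bigr => l _ do rewrite !mxE mulrBl -/C
  (mulrAC _ (C j _)) -(mulrA (_ / _)).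
rewrite sumrB CM -mulr_sumr CM (inj_eq lift_inj) eq_liftF.
by rewrite sub0r mulrN opprK mulrA divfK // subrK.
Qed.

(** The trace of the formula above: M^-1 is Hermitian, so the products
    (M^-1)_ij (M^-1)_ji sum up to the squared norm of its row j. *)
Lemma mxtrace_invmx_delete m (M : 'M[K]_m.+1) j : posdefmx M ->
  \tr (invmx (mxsub (lift j) (lift j) M)) =
    \tr (invmx M) - sqnorm (row j (invmx M)) / invmx M j j.
Proof.
move=> M_pd; set C := invmx M.
have Cjj : C j j != 0 by rewrite gt_eqF // invmx_diag_gt0.
rewrite invmx_delete ?posdefmx_unit // /mxtrace.
under eq_bigr => i _ do rewrite mxE.
rewrite sumrB -mulr_suml.
rewrite [X in _ = X - _](bigD1_ord j) //= /sqnorm (bigD1_ord j) //= mulrDl.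
rewrite mxE -normKE -(invmx_entryC M_pd) mulfK // opprD addrACA subrr add0r.
congr (_ - _ / _); apply: eq_bigr => i _.
by rewrite mxE -normKE -(invmx_entryC M_pd) mulrC.
Qed.

(** * The barrier argument *)

(** Some ratio a_j / w_j is at least the mean of the ratios with weights w.  The
    order of K is partial, so the argument by contradiction needs that all
    these quantities are real. *)
Lemma exists_ratio_ge m (w a : 'I_m.+1 -> K) :
  (forall j, 0 < w j) -> (forall j, 0 <= a j) ->
  exists j, w j * (\sum_i a i) <= a j * (\sum_i w i).
Proof.
move=> w_gt0 a_ge0; apply/'exists_idP; case: (boolP [exists _, _]) => //.
rewrite negb_exists => /forallP no.
have rw i : w i \is Num.real by rewrite gtr0_real.
have ra i : a i \is Num.real by rewrite ger0_real.
suff: \sum_j a j * (\sum_i w i) < \sum_j w j * (\sum_i a i).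
  by rewrite -!mulr_suml mulrC ltxx.
apply: ltr_sum; first by apply/hasP; exists ord0; rewrite ?mem_index_enum.
by move=> j _; rewrite real_ltNge ?no // rpredM // rpred_sum.
Qed.

(** The value of delta is chosen so that delta <= M / 2, which keeps N^-1 below
    2 M^-1, and so that delta * tr N^-1 <= 1, which lets one deletion undo the
    effect of subtracting delta. *)
Lemma barrier_step m (M : 'M[K]_m.+1) (phi : K) :
  posdefmx M -> \tr (invmx M) <= phi ->
  exists j, let N := mxsub (lift j) (lift j) (M - ((2 * phi)^-1)%:M) in
    posdefmx N /\ \tr (invmx N) <= phi.
Proof.
move=> M_pd trB; set delta := (2 * phi)^-1; set N := M - delta%:M.
set B := invmx M in trB *; set C := invmx N.
have phi_gt0 : 0 < phi.
  apply: lt_le_trans trB; rewrite /mxtrace big_ord_recl ltr_wpDr ?invmx_diag_gt0 //.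
  by apply: sumr_ge0 => i _; rewrite ltW ?invmx_diag_gt0.
have delta_gt0 : 0 < delta by rewrite invr_gt0 mulr_gt0.
have delta_phi : delta * phi = 2^-1.
  by rewrite /delta invfM divfK // gt_eqF.
have shift_half u : delta * sqnorm u <= 2^-1 * form theta M u u.
  rewrite -delta_phi -mulrA; apply: ler_wpM2l (ltW delta_gt0) _ _ _.
  apply: le_trans (sqnorm_le_form M_pd u) _.
  by rewrite ler_wpM2r // posdefmx_form_ge0.
have halfE (x : K) : x = 2^-1 * x + 2^-1 * x.
  by rewrite -mulrDl -mulr2n -[_ *+ 2]mulr_natr mulVf ?mul1r // pnatr_eq0.
have form_N_ge u : 2^-1 * form theta M u u <= form theta N u u.
  by rewrite form_shift lerBrDr [X in _ <= X]halfE lerD2l.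
have N_pd : posdefmx N.
  split=> [|u u_neq0]; last first.
    by apply: lt_le_trans (form_N_ge u); rewrite mulr_gt0 ?invr_gt0 // (proj2 M_pd).
  apply/sesquiP/matrixP => i j; rewrite expr0 scale1r !mxE.
  rewrite rmorphB rmorphMn /= -(posdefmx_entryC M_pd) (theta_ge0 (ltW _)) //.
  by rewrite eq_sym.
(* N >= M / 2 is inverted through the variational formula for M at half of the
   row of C. *)
have C_le j : C j j <= 2 * B j j.
  have := invmx_diag_ge M_pd j (2^-1 *: row j C).
  rewrite !mxE formZl formZr !rmorphM /= -(invmx_entryC N_pd).
  have h2 : theta 2^-1 = 2^-1 by apply: theta_ge0; rewrite invr_ge0.
  rewrite h2 -halfE -(ler_pM2l (ltr0Sn K 1)) => /(le_trans _) -> //.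
  rewrite mulrBr mulVKf ?pnatr_eq0 // mulr_natl mulr2n -addrA lerDl.
  by rewrite subr_ge0; apply: le_trans (form_N_ge _) _; rewrite form_row_inv_diag.
(* First order effect of the shift: the test vector is now the whole row of C. *)
have B_ge j : C j j - delta * sqnorm (row j C) <= B j j.
  apply: le_trans (invmx_diag_ge M_pd j (row j C)).
  rewrite -[form _ _ _ _](subrK (delta * sqnorm (row j C))) -form_shift -/N.
  by rewrite form_row_inv_diag // !mxE -(invmx_entryC N_pd) opprD addrA addrK.
have [j hj] := exists_ratio_ge (invmx_diag_gt0 N_pd) (fun j => sqnorm_ge0 (row j C)).
exists j; split; first by apply: posdefmx_mxsub => //; apply: lift_inj.
rewrite mxtrace_invmx_delete //.
have C_gt0 := invmx_diag_gt0 N_pd j.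
have trC_le : \tr C <= 2 * phi.
  by apply: le_trans (ler_wpM2l _ trB) => //; rewrite mulr_sumr ler_sum.
have trC_sub : \tr C - delta * \sum_i sqnorm (row i C) <= phi.
  by apply: le_trans trB; rewrite mulr_sumr -sumrB ler_sum.
apply: le_trans trC_sub; rewrite lerD2l lerN2 ler_pdivlMr // -mulrA -/C.
rewrite [_ * C j j]mulrC; apply: le_trans (ler_wpM2l (ltW delta_gt0) hj) _.
rewrite mulrCA ler_piMr ?sqnorm_ge0 //.
apply: le_trans (ler_wpM2l (ltW delta_gt0) trC_le) _.
by rewrite mulrCA delta_phi mulfV ?pnatr_eq0.
Qed.

Lemma barrier_selection k m (M : 'M[K]_(k + m)) (phi : K) :
  posdefmx M -> \tr (invmx M) <= phi ->
  exists h : 'I_m -> 'I_(k + m), injective h /\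
    let N := mxsub h h M - (k%:R * (2 * phi)^-1)%:M in
    posdefmx N /\ \tr (invmx N) <= phi.
Proof.
elim: k M => [|k IHk] M M_pd trM.
  by exists id; split=> //; rewrite mxsub_id mul0r raddf0 subr0.
have [j [N_pd trN]] := barrier_step M_pd trM.
have [h [h_inj [N'_pd trN']]] := IHk _ N_pd trN.
have lh_inj : injective (lift j \o h) by apply: inj_comp => //; apply: lift_inj.
exists (lift j \o h); split=> //=.
suff -> : mxsub (lift j \o h) (lift j \o h) M - (k.+1%:R * (2 * phi)^-1)%:M =
  mxsub h h (mxsub (lift j) (lift j) (M - ((2 * phi)^-1)%:M)) - (k%:R * (2 * phi)^-1)%:M by [].
have -> : k.+1%:R * (2 * phi)^-1 = (2 * phi)^-1 + k%:R * (2 * phi)^-1.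
  by rewrite -add1n natrD mulrDl mul1r.
apply/matrixP => p q; rewrite !mxE /= (inj_eq lift_inj) (inj_eq h_inj).
by rewrite -addrA -opprD -mulrnDl.
Qed.

End PositiveDefinite.

(** * Gram matrices of biorthogonal systems *)

(** The upper estimate needs a constant above L, the lower one a constant whose
    inverse square is at most eps * d^2 / 2; the summand 1 keeps the sum positive
    for all arguments, also where both other terms vanish. *)
Definition riesz_bound (R : realType) (eps d L : R) : R :=
  1 + `|L| + Num.sqrt (2 / (eps * d ^+ 2)).

Section RieszBound.
Variables (R : realType) (eps d L : R).

Lemma riesz_bound_gt0 : 0 < riesz_bound eps d L.
Proof. by rewrite /riesz_bound -addrA ltr_wpDr // addr_ge0 ?sqrtr_ge0. Qed.

Lemma le_riesz_bound : L <= riesz_bound eps d L.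
Proof.
have := ler_norm L; have := sqrtr_ge0 (2 / (eps * d ^+ 2)).
by rewrite /riesz_bound; lra.
Qed.

Lemma riesz_boundV_sqr_le : 0 < eps -> 0 < d ->
  (riesz_bound eps d L)^-1 ^+ 2 <= eps * d ^+ 2 / 2.
Proof.
move=> eps_gt0 d_gt0; have ed_gt0 : 0 < eps * d ^+ 2 by rewrite mulr_gt0 ?exprn_gt0.
rewrite exprVn -[leRHS]invrK lef_pV2 ?posrE ?exprn_gt0 ?riesz_bound_gt0 //;
  last by rewrite invr_gt0 divr_gt0.
rewrite invf_div -[leLHS]sqr_sqrtr; last by rewrite divr_ge0 // ltW.
rewrite ler_sqr ?nnegrE ?sqrtr_ge0 ?(ltW riesz_bound_gt0) //.
by rewrite /riesz_bound lerDr addr_ge0.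
Qed.

End RieszBound.

(** The map [emb] embeds R in K as the real elements; [re] inverts it on the
    nonnegative elements, which is where norms are read. *)
Section Biorthogonal.
Variables (R : realType) (K : numFieldType) (theta : involutive_rmorphism K).
Variables (re : K -> R) (emb : {rmorphism R -> K}).
Hypothesis normKE : forall x : K, x * theta x = `|x| ^+ 2.
Hypothesis ler_emb : {mono emb : x y / x <= y}.
Hypothesis emb_re : forall x : K, 0 <= x -> emb (re x) = x.

Lemma re_ge0 (x : K) : 0 <= x -> 0 <= re x.
Proof. by move=> x_ge0; rewrite -ler_emb rmorph0 emb_re. Qed.

Lemma emb_l2norm_sqr (I : finType) (s : {set I}) (a : I -> K) :
  emb (l2norm re s a ^+ 2) = \sum_(i in s) `|a i| ^+ 2.
Proof.
rewrite sqr_sqrtr; last by apply: sumr_ge0 => i _; rewrite exprn_ge0 ?re_ge0.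
by rewrite rmorph_sum; apply: eq_bigr => i _; rewrite rmorphXn /= emb_re.
Qed.

Section Gram.
Variables (V : lmodType K) (dp : {dot V for theta}).

Lemma dot_ge0 v : 0 <= dp v v.
Proof.
have [->|/neq0_dnorm_gt0/ltW //] := eqVneq v 0.
by rewrite linear0l.
Qed.

Lemma emb_dotnorm_sqr v : emb (dotnorm re dp v ^+ 2) = dp v v.
Proof. by rewrite sqr_sqrtr ?emb_re ?re_ge0 ?dot_ge0. Qed.

Definition gram m (f : 'I_m -> V) := \matrix_(i, j) dp (f i) (f j).

Lemma form_gram m (f : 'I_m -> V) u v :
  form theta (gram f) u v = dp (\sum_i u 0 i *: f i) (\sum_j v 0 j *: f j).
Proof.
rewrite /form -mulmxA mxE linear_sumlz; apply: eq_bigr => i _.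
rewrite linearZl_LR mxE linear_sumr; congr (_ * _); apply: eq_bigr => j _.
by rewrite (linearZr_LR dp) /= !mxE mulrC.
Qed.

Section Dual.
Variables (n : nat) (f fs : 'I_n -> V).
Hypothesis dual : forall i j, dp (fs i) (f j) = (i == j)%:R.

Lemma dot_dual_sum i (u : 'I_n -> K) :
  dp (fs i) (\sum_j u j *: f j) = theta (u i).
Proof.
rewrite linear_sumr (bigD1 i) //= big1 => [|j j_neq_i].
  by rewrite (linearZr_LR dp) /= dual eqxx mulr1 addr0.
by rewrite (linearZr_LR dp) /= dual eq_sym (negPf j_neq_i) mulr0.
Qed.

Lemma gram_posdef : posdefmx theta (gram f).
Proof.
split=> [|u u_neq0].
  by apply/sesquiP/matrixP => i j; rewrite expr0 scale1r !mxE (hermC dp) mul1r.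
rewrite form_gram; apply: neq0_dnorm_gt0; apply: contra_neq u_neq0 => sum0.
apply/rowP => i; rewrite mxE -[LHS](@rmorphK _ theta) -(dot_dual_sum i (u 0)).
by rewrite sum0 linear0r rmorph0.
Qed.

(** The vector c below is the orthogonal projection of [fs i] on the span of
    the f_k; its squared norm is the diagonal entry, and projecting does not
    increase the norm. *)
Lemma invmx_gram_diag_le i : invmx (gram f) i i <= dp (fs i) (fs i).
Proof.
set C := invmx _; pose c := \sum_k C i k *: f k.
have Cii : theta (C i i) = C i i by rewrite -(invmx_entryC gram_posdef).
have dot_c : dp c c = C i i.
  rewrite -(form_row_inv_diag gram_posdef) form_gram.
  by congr (dp _ _); apply: eq_bigr => k _; rewrite !mxE.
have dot_fsc : dp (fs i) c = C i i by rewrite dot_dual_sum Cii.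
have dot_cfs : dp c (fs i) = C i i.
  transitivity (theta (dp (fs i) c)); last by rewrite dot_fsc Cii.
  by rewrite [LHS](hermC dp) mul1r.
have := dot_ge0 (fs i - c).
rewrite linearBl !linearBr /= dot_c dot_fsc dot_cfs subrr subr0.
by rewrite subr_ge0.
Qed.

End Dual.
End Gram.

Lemma biorthogonal_riesz n (V : lmodType K) (dp : {dot V for theta})
    (f fs : 'I_n -> V) (d L eps : R) :
  (0 < n)%N -> 0 < d -> 0 < eps -> eps < 1 ->
  biorthogonal_system re dp f fs d ->
  hilbertian_constant re dp f L ->
  exists sigma : {set 'I_n},
    (1 - eps) * n%:R <= #|sigma|%:R /\
    riesz_basis_constant re dp sigma f (riesz_bound eps d L).
Proof.
move=> n_gt0 d_gt0 eps_gt0 eps_lt1 [_ fs_le dual] f_hilb.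
pose k := Num.truncn (eps * n%:R).
have /andP[k_le k_gt] : k%:R <= eps * n%:R < k.+1%:R.
  by rewrite truncn_itv // mulr_ge0 // ltW.
have k_le_n : (k <= n)%N.
  rewrite -(ler_nat R) (le_trans k_le) // ler_piMl // ltW //.
(* k indices are to be deleted and m kept. *)
have [m def_n] : exists m, n = (k + m)%N by exists (n - k)%N; rewrite subnKC.
clearbody k; subst n.
have A_pd := gram_posdef dual; set A := gram dp f in A_pd.
pose phi : R := (k + m)%:R / d ^+ 2.
have trA : \tr (invmx A) <= emb phi.
  rewrite /phi mulrC mulr_natr rmorphMn -[(k + m)%N as X in _ *+ X]card_ord -sumr_const.
  apply: ler_sum => i _; apply: le_trans (invmx_gram_diag_le dual i) _.
  rewrite -emb_dotnorm_sqr ler_emb -exprVn ler_sqr ?nnegrE ?sqrtr_ge0 ?fs_le //.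
  by rewrite invr_ge0 ltW.
have [h [h_inj [N_pd trN]]] := barrier_selection normKE A_pd trA.
exists [set h i | i : 'I_m]; split.
  by rewrite card_imset // card_ord; move: k_le; rewrite natrD; lra.
move=> a; set sigma := [set _ | _ in _]; set g := riesz_bound _ _ _.
have g_gt0 : 0 < g by apply: riesz_bound_gt0.
set x := l2norm re sigma a; set y := dotnorm re dp _.
have x_ge0 : 0 <= x by apply: sqrtr_ge0.
have y_ge0 : 0 <= y by apply: sqrtr_ge0.
apply/andP; split; last first.
  (* The Hilbertian constant is applied to the extension of a by zero. *)
  pose b i := if i \in sigma then a i else 0.
  have := f_hilb b; have -> : l2norm re [set: _] b = x.
    congr Num.sqrt; rewrite [LHS]big_mkcond [RHS]big_mkcond /=; apply: eq_bigr => i _.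
    rewrite inE /b; case: ifP => // _.
    have : emb (re `|0 : K|) = 0 by rewrite emb_re ?normr0.
    by move/eqP; rewrite fmorph_eq0 => /eqP ->; rewrite expr0n.
  have -> : \sum_i b i *: f i = \sum_(i in sigma) a i *: f i.
    rewrite [RHS]big_mkcond; apply: eq_bigr => i _.
    by rewrite /b; case: ifP => // _; rewrite scale0r.
  by move/le_trans; apply; rewrite ler_wpM2r // le_riesz_bound.
pose u : 'rV[K]_m := \row_p a (h p).
have emb_x : emb (x ^+ 2) = sqnorm u.
  rewrite emb_l2norm_sqr big_imset /=; last by move=> p q _ _; apply: h_inj.
  by apply: eq_bigr => p _; rewrite mxE.
have emb_y : emb (y ^+ 2) = form theta (mxsub h h A) u u.
  rewrite emb_dotnorm_sqr big_imset /=; last by move=> p q _ _; apply: h_inj.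
  have -> : mxsub h h A = gram dp (f \o h) by apply/matrixP => p q; rewrite !mxE.
  by rewrite form_gram; congr (dp _ _); apply: eq_bigr => p _; rewrite mxE.
(* The part left above the barrier is at least 1 / phi, by the trace bound. *)
have xy : x ^+ 2 <= phi * (y ^+ 2 - k%:R / (2 * phi) * x ^+ 2).
  clearbody phi; move: (x ^+ 2) (y ^+ 2) emb_x emb_y => x2 y2 emb_x emb_y.
  rewrite -ler_emb rmorphM rmorphB !rmorphM fmorphV rmorphM !rmorph_nat.
  rewrite emb_x emb_y -form_shift //.
  apply: le_trans (sqnorm_le_form normKE N_pd u) _.
  by apply: ler_wpM2r; rewrite // posdefmx_form_ge0.
have n_gt0R : 0 < (k + m)%:R :> R by rewrite ltr0n.
have phi_gt0 : 0 < phi by rewrite divr_gt0 ?exprn_gt0.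
have x2_le : eps * d ^+ 2 / 2 * x ^+ 2 <= y ^+ 2.
  rewrite -(ler_pM2l phi_gt0).
  have -> : phi * (eps * d ^+ 2 / 2 * x ^+ 2) = eps * (k + m)%:R * (x ^+ 2 / 2).
    by rewrite /phi; field; rewrite gt_eqF.
  have xx_ge0 : 0 <= x ^+ 2 / 2 by rewrite divr_ge0 ?exprn_ge0.
  (* The 1 / phi above the barrier absorbs the rounding of eps * n to k. *)
  apply: le_trans (ler_wpM2r xx_ge0 (ltW k_gt)) _.
  have -> : k.+1%:R * (x ^+ 2 / 2) = (k%:R / 2) * x ^+ 2 + x ^+ 2 / 2 :> R.
    by rewrite -natr1; field.
  have : phi * (y ^+ 2 - k%:R / (2 * phi) * x ^+ 2) =
    phi * y ^+ 2 - (k%:R / 2) * x ^+ 2 by field; rewrite gt_eqF.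
  by move: xy xx_ge0; lra.
have gx_ge0 : 0 <= g^-1 * x by rewrite mulr_ge0 // invr_ge0 ltW.
suff : (g^-1 * x) ^+ 2 <= y ^+ 2 by rewrite ler_sqr ?nnegrE.
rewrite exprMn; apply: le_trans x2_le; rewrite ler_wpM2r ?exprn_ge0 //.
exact: riesz_boundV_sqr_le.
Qed.

End Biorthogonal.

Theorem theorem2p1 (R : realType) :
  exists g : R -> R -> R -> R,
    [/\ forall x y z : R, 0 < g x y z,
        (* real scalars *)
        forall (n : nat) (V : vectType R) (dp : {dot V for idfun})
               (f fs : 'I_n -> V) (d L eps : R),
          (0 < n)%N -> \dim {: V} = n ->
          0 < d -> d <= 1 -> 0 < eps -> eps < 1 ->
          biorthogonal_system idfun dp f fs d ->
          hilbertian_constant idfun dp f L ->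
          exists sigma : {set 'I_n},
            (1 - eps) * n%:R <= #|sigma|%:R /\
            riesz_basis_constant idfun dp sigma f (g eps d L)
      & (* complex scalars *)
        forall (n : nat) (V : vectType R[i]) (dp : {dot V for conjC})
               (f fs : 'I_n -> V) (d L eps : R),
          (0 < n)%N -> \dim {: V} = n ->
          0 < d -> d <= 1 -> 0 < eps -> eps < 1 ->
          biorthogonal_system (@complex.Re R) dp f fs d ->
          hilbertian_constant (@complex.Re R) dp f L ->
          exists sigma : {set 'I_n},
            (1 - eps) * n%:R <= #|sigma|%:R /\
            riesz_basis_constant (@complex.Re R) dp sigma f (g eps d L)].
Proof.
exists (@riesz_bound R); split; first exact: riesz_bound_gt0.
  move=> n V dp f fs d L eps n_gt0 _ d_gt0 _ eps_gt0 eps_lt1.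
  apply: (@biorthogonal_riesz _ _ idfun idfun idfun) => // x.
  by rewrite -expr2 real_normK ?num_real.
move=> n V dp f fs d L eps n_gt0 _ d_gt0 _ eps_gt0 eps_lt1.
apply: (@biorthogonal_riesz _ _ conjC (@complex.Re R) (real_complex R)) => //.
- by move=> x; rewrite -normCK.
- exact: lecR.
- by move=> x /ger0_real /RRe_real.
Qed.
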